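(* For any $q\ge5$, in $\mathrm{PG}(3,q)$, the imaginary chords of the twisted cubic $\mathcal{C}$ form an orbit under $G_q$. The subgroup of $G_q$ fixing an imaginary chord has size $2(q+1)$. For $q$ odd, the line $\ell_1$ through the points $\mathbf{P}(1,0,\rho,0)$ and $\mathbf{P}(0,1,0,\rho)$, with $\rho$ a non-square element of $\mathbb{F}_q$, is an imaginary chord. An element $\Psi$ of the subgroup of $G_q$ fixing $\ell_1$ has a matrix of the form \[ \left[ \begin{array}{cccc} \alpha d^3&\alpha \rho b d^2&\alpha \rho^2 b^2 d&\alpha \rho^3 b^3\\ 3bd^2&d^3+2\rho b^2d&\rho^2b^3+2\rho b d^2&3\rho^2b^2d\\ 3\alpha b^2d&\alpha\rho b^3+2\alpha bd^2&\alpha d^3+2\alpha\rho b^2 d&3\alpha\rho bd^2\\ b^3&b^2d&bd^2&d^3 \end{array} \right], \] with $\alpha \in \{ -1,1\}$ and $b,d \in \mathbb{F}_q$ not both $0$. For $q$ even, the line $\ell_2$ through the points $\mathbf{P}(\eta+1,1,1,0)$ and $\mathbf{P}(\eta,\eta,0,1)$, with $\eta$ an element of $\mathbb{F}_q$ of absolute trace $1$, is an imaginary chord. An element $\Psi$ of the subgroup of $G_q$ fixing $\ell_2$ has a matrix of the form \[ \left[ \begin{array}{cccc} A^3&cA^2&c^2A&c^3\\ A^2B&dA^2&c^2B&c^2d\\ AB^2&cB^2&Ad^2&cd^2\\ B^3&dB^2&d^2B&d^3 \end{array} \right], \] where $A = \alpha c+d$, $B= \eta c+(\alpha+1)d$,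 $\alpha \in \{ 0,1\}$, and $c,d \in \mathbb{F}_q$ not both $0$.
   Context: Let $\mathbf{P}(x_0,x_1,x_2,x_3)$ denote the point of $\mathrm{PG}(3,q)$ with homogeneous coordinates $x_i\in\mathbb{F}_q$. Let $\mathcal{C}=\{P(t): t\in\mathbb{F}_q\cup\{\infty\}\}$ be the twisted cubic, where $P(t)=\mathbf{P}(t^3,t^2,t,1)$ for $t\in\mathbb{F}_q$ and $P(\infty)=\mathbf{P}(1,0,0,0)$. Let $G_q$ be the group of projectivities of $\mathrm{PG}(3,q)$ fixing $\mathcal{C}$; for $q\ge5$, $G_q\cong PGL(2,q)$, and a projectivity of $G_q$ acts on points by $[x_0,x_1,x_2,x_3]\mapsto[x_0,x_1,x_2,x_3]M$ where $M$ has the general form \[ M=\left[ \begin{array}{cccc} a^3&a^2c&ac^2&c^3\\ 3a^2b&a^2d+2abc&bc^2+2acd&3c^2d\\ 3ab^2&b^2c+2abd&ad^2+2bcd&3cd^2\\ b^3&b^2d&bd^2&d^3 \end{array} \right],\quad a,b,c,d\in\mathbb{F}_q,\ ad-bc\ne0, \] defined up to a nonzero scalar factor. An imaginary chord of $\mathcal{C}$ is a line of $\mathrm{PG}(3,q)$ joining a pair of complex conjugate points of $\mathcal{C}$ (points $P(t)$ with $t\in\mathbb{F}_{q^2}\setminus\mathbb{F}_q$ and $P(t^q)$). *)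

(* Defs.v *)
From HB Require Import structures.
From mathcomp Require Import all_boot all_order all_algebra all_field.
Set Implicit Arguments. Unset Strict Implicit. Unset Printing Implicit Defensive.
Import GRing.Theory.
Local Open Scope ring_scope.

Section Defs.
Variable F : fieldType.

Definition mx4 (m00 m01 m02 m03 m10 m11 m12 m13 m20 m21 m22 m23
                m30 m31 m32 m33 : F) : 'M[F]_4 :=
  \matrix_(i < 4, j < 4)
    match nat_of_ord i, nat_of_ord j with
    | 0, 0 => m00 | 0, 1 => m01 | 0, 2 => m02 | 0, _ => m03
    | 1, 0 => m10 | 1, 1 => m11 | 1, 2 => m12 | 1, _ => m13
    | 2, 0 => m20 | 2, 1 => m21 | 2, 2 => m22 | 2, _ => m23
    | _, 0 => m30 | _, 1 => m31 | _, 2 => m32 | _, _ => m33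
    end.

(* the matrix M(a,b,c,d) of the projectivity of G_q; points are row vectors,
   acting by x |-> x *m M *)
Definition Mabcd (a b c d : F) : 'M[F]_4 :=
  mx4 (a^+3) (a^+2*c) (a*c^+2) (c^+3)
      (3%:R*a^+2*b) (a^+2*d + 2%:R*a*b*c) (b*c^+2 + 2%:R*a*c*d) (3%:R*c^+2*d)
      (3%:R*a*b^+2) (b^+2*c + 2%:R*a*b*d) (a*d^+2 + 2%:R*b*c*d) (3%:R*c*d^+2)
      (b^+3) (b^+2*d) (b*d^+2) (d^+3).

Definition pt (x0 x1 x2 x3 : F) : 'rV[F]_4 :=
  \row_(j < 4) match nat_of_ord j with 0 => x0 | 1 => x1 | 2 => x2 | _ => x3 end.

Definition Pt (t : F) : 'rV[F]_4 := pt (t^+3) (t^+2) t 1.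

(* a line of PG(3,q) is given by a 2x4 matrix of rank 2 (its row space);
   the line through two points *)
Definition line_through (u v : 'rV[F]_4) : 'M[F]_(2,4) := col_mx u v.
Definition is_line (L : 'M[F]_(2,4)) : bool := \rank L == 2%N.
End Defs.

Section FinDefs.
Variable F : finFieldType.

(* the projectivity of PG(3,q) induced by an invertible matrix M:
   its class of nonzero scalar multiples *)
Definition projclass (M : 'M[F]_4) : {set 'M[F]_4} :=
  [set N : 'M[F]_4 | [exists k : F, (k != 0) && (N == k *: M)]].

(* the group G_q of projectivities fixing the twisted cubic, realised as
   the set of projectivities with matrices M(a,b,c,d), ad - bc != 0 *)
Definition Gq : {set {set 'M[F]_4}} :=
  [set projclass (Mabcd x.1.1 x.1.2 x.2.1 x.2.2)
     | x : (F * F) * (F * F) & x.1.1 * x.2.2 - x.1.2 * x.2.1 != 0].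

Definition stab (L : 'M[F]_(2,4)) : {set {set 'M[F]_4}} :=
  [set g in Gq | [forall N in g, (L *m N == L)%MS]].

(* imaginary chord: a line of PG(3,q) whose extension to F_{q^2} (here K,
   with embedding f) is the line joining P(t) and P(t^q), t in F_{q^2} \ F_q *)
Definition imag_chord (K : finFieldType) (f : {rmorphism F -> K})
  (L : 'M[F]_(2,4)) : Prop :=
  is_line L /\
  exists t : K, t \notin codom f /\
    (map_mx f L == line_through (Pt t) (Pt (t ^+ #|F|)))%MS.

Definition is_square (x : F) : bool := [exists y : F, y ^+ 2 == x].

Definition abs_trace (x : F) : F := \sum_(i < logn 2 #|F|) x ^+ (2 ^ i).

Definition Psi_odd (rho alpha b d : F) : 'M[F]_4 :=
  mx4 (alpha*d^+3) (alpha*rho*b*d^+2) (alpha*rho^+2*b^+2*d) (alpha*rho^+3*b^+3)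
      (3%:R*b*d^+2) (d^+3 + 2%:R*rho*b^+2*d) (rho^+2*b^+3 + 2%:R*rho*b*d^+2)
        (3%:R*rho^+2*b^+2*d)
      (3%:R*alpha*b^+2*d) (alpha*rho*b^+3 + 2%:R*alpha*b*d^+2)
        (alpha*d^+3 + 2%:R*alpha*rho*b^+2*d) (3%:R*alpha*rho*b*d^+2)
      (b^+3) (b^+2*d) (b*d^+2) (d^+3).

Definition Psi_even (eta alpha c d : F) : 'M[F]_4 :=
  let A := alpha * c + d in
  let B := eta * c + (alpha + 1) * d in
  mx4 (A^+3) (c*A^+2) (c^+2*A) (c^+3)
      (A^+2*B) (d*A^+2) (c^+2*B) (c^+2*d)
      (A*B^+2) (c*B^+2) (A*d^+2) (c*d^+2)
      (B^+3) (d*B^+2) (d^+2*B) (d^+3).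

Definition ell1 (rho : F) : 'M[F]_(2,4) :=
  line_through (pt 1 0 rho 0) (pt 0 1 0 rho).
Definition ell2 (eta : F) : 'M[F]_(2,4) :=
  line_through (pt (eta + 1) 1 1 0) (pt eta eta 0 1).
End FinDefs.

(* Main.v *)
(* A matrix M(a,b,c,d) sends P(t) to P((a t + b) / (c t + d)), over F_q as over
   F_{q^2}, and commutes with Frobenius; hence it sends the imaginary chord through
   P(t) and P(t^q) to the one through the images.  Since (1, t) is an F_q-basis of
   F_{q^2}, every t' is a t + b, which gives transitivity.  As no three points of the
   cubic are collinear, M fixes the chord iff t goes to t or to t^q.  With
   t^2 = s t - n, each of these conditions determines (a, b) linearly from (c, d), and
   (c, d) only matters up to scalars, so the stabiliser has 2 (q + 1) elements; the
   chords ell1 and ell2 are the cases (s, n) = (0, - 1 / rho) and (1, eta). *)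
Require Import Defs.
From HB Require Import structures.
From mathcomp Require Import all_boot all_order all_algebra all_field.
From mathcomp Require Import ring.
Import GRing.Theory.
Local Open Scope ring_scope.

Set Implicit Arguments.
Unset Strict Implicit.
Unset Printing Implicit Defensive.

(** * Homogeneous parameters on the cubic: [vpt t 1] is P(t), [vpt 1 0] is P(infinity) *)

Definition vpt (F : fieldType) (x y : F) : 'rV[F]_4 :=
  pt (x ^+ 3) (x ^+ 2 * y) (x * y ^+ 2) (y ^+ 3).

Lemma ord4E (P : 'I_4 -> Prop) :
  P (inord 0) -> P (inord 1) -> P (inord 2) -> P (inord 3) -> forall i, P i.
Proof.
move=> P0 P1 P2 P3 i; have := inord_val i.
by case: i => -[|[|[|[|m]]]] //= lti <-.
Qed.

Lemma pt_inj (F : fieldType) (x0 x1 x2 x3 y0 y1 y2 y3 : F) :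
  pt x0 x1 x2 x3 = pt y0 y1 y2 y3 <-> [/\ x0 = y0, x1 = y1, x2 = y2 & x3 = y3].
Proof.
split=> [|[-> -> -> ->]//] /rowP e.
by move: (e (inord 0)) (e (inord 1)) (e (inord 2)) (e (inord 3)); rewrite !mxE !inordK.
Qed.

Lemma scale_pt (F : fieldType) (k x0 x1 x2 x3 : F) :
  k *: pt x0 x1 x2 x3 = pt (k * x0) (k * x1) (k * x2) (k * x3).
Proof. by apply/rowP; elim/ord4E; rewrite !mxE !inordK. Qed.

Lemma add_pt (F : fieldType) (x0 x1 x2 x3 y0 y1 y2 y3 : F) :
  pt x0 x1 x2 x3 + pt y0 y1 y2 y3 = pt (x0 + y0) (x1 + y1) (x2 + y2) (x3 + y3).
Proof. by apply/rowP; elim/ord4E; rewrite !mxE !inordK. Qed.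

Lemma map_pt (F K : fieldType) (f : {rmorphism F -> K}) (x0 x1 x2 x3 : F) :
  map_mx f (pt x0 x1 x2 x3) = pt (f x0) (f x1) (f x2) (f x3).
Proof. by apply/rowP; elim/ord4E; rewrite !mxE !inordK. Qed.

Lemma map_Mabcd (F K : fieldType) (f : {rmorphism F -> K}) (a b c d : F) :
  map_mx f (Mabcd a b c d) = Mabcd (f a) (f b) (f c) (f d).
Proof.
apply/matrixP; elim/ord4E; elim/ord4E; rewrite !mxE !inordK //=; ring.
Qed.

(** [Mabcd] is the symmetric cube of a 2x2 matrix, so the parameter (x : y) undergoes a linear
    substitution. *)
Lemma vpt_Mabcd (F : fieldType) (x y a b c d : F) :
  vpt x y *m Mabcd a b c d = vpt (a * x + b * y) (c * x + d * y).
Proof.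
apply/rowP => j; rewrite mxE 4!big_ord_recl big_ord0.
by move: j; elim/ord4E; rewrite !mxE !inordK //=; ring.
Qed.

Lemma Pt_vpt (F : fieldType) (t : F) : Pt t = vpt t 1.
Proof. by rewrite /Pt /vpt !expr1n !mulr1. Qed.

Lemma vpt_scale (F : fieldType) (k x y : F) : vpt (k * x) (k * y) = k ^+ 3 *: vpt x y.
Proof. by rewrite scale_pt; apply/pt_inj; split; ring. Qed.

Lemma vpt_Pt (F : fieldType) (x y : F) : y != 0 -> vpt x y = y ^+ 3 *: Pt (x / y).
Proof.
by move=> y0; rewrite Pt_vpt -vpt_scale mulr1 mulrC divfK.
Qed.

(** The last two coordinates suffice: multiply x y^2 = k x' y'^2 by y and y^3 = k y'^3 by x, then
    cancel k y'^2. If y = 0, then y' = 0 as well. *)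
Lemma vpt_proportional (F : fieldType) (k x y x' y' : F) : k != 0 ->
  vpt x y = k *: vpt x' y' -> x * y' = x' * y.
Proof.
move=> k0; rewrite scale_pt => /pt_inj[e0 e1 e2 e3].
have [y0|y0] := eqVneq y 0.
  have y'0 : y' = 0.
    apply/eqP; have /eqP := e3; rewrite y0 expr0n eq_sym mulf_eq0 (negPf k0).
    by rewrite expf_eq0.
  by rewrite y0 y'0 !mulr0.
have : k * y' ^+ 2 * (x * y' - x' * y) = 0.
  rewrite mulrBr; apply/eqP; rewrite subr_eq0; apply/eqP.
  transitivity (x * y ^+ 3); first by rewrite e3; ring.
  by transitivity (x * y ^+ 2 * y); [ring | rewrite e2; ring].
have y'0 : y' != 0.
  by apply: contra_neq y0 => y'0; apply/eqP; have /eqP := e3;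
     rewrite y'0 expr0n mulr0 expf_eq0.
by move/eqP; rewrite mulf_eq0 mulf_eq0 expf_eq0 (negPf k0) (negPf y'0) /= subr_eq0 => /eqP.
Qed.

(** * Lines joining two points of the cubic *)

Lemma Pt_line_through (F : fieldType) (w t u : F) :
  (Pt w <= line_through (Pt t) (Pt u))%MS -> w = t \/ w = u.
Proof.
have -> : (Pt w <= line_through (Pt t) (Pt u))%MS = (Pt w <= Pt t + Pt u)%MS.
  by rewrite (addsmxE (Pt t) (Pt u)).
case/sub_addsmxP => [[x y]] /=.
rewrite (mx11_scalar x) (mx11_scalar y) !mul_scalar_mx !scale_pt add_pt.
case/pt_inj => _ e1 e2 e3.
(* The expanded quadratic (X - t)(X - u) is a linear form in the last three coordinates; it kills
   P(t) and P(u), hence every point of their line. *)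
have /eqP : (w - t) * (w - u) = 0.
  transitivity (w ^+ 2 - (t + u) * w + t * u * 1); first by ring.
  by rewrite e1 e2 e3; ring.
by rewrite mulf_eq0 !subr_eq0 => /orP[]/eqP; [left|right].
Qed.

Lemma rank_line_through (F : fieldType) (t u : F) : t != u ->
  \rank (line_through (Pt t) (Pt u)) = 2%N.
Proof.
move=> tu.
have tu0 : t - u != 0 by rewrite subr_eq0.
(* The right inverse is the inverse of the block (t 1; u 1) formed by the last two columns, padded
   with zeros. *)
apply/eqP/row_freeP; exists (\matrix_(i < 4, j < 2)
   match nat_of_ord i, nat_of_ord j with
   | 2, 0 => (t - u)^-1 | 3, 0 => - u / (t - u)
   | 2, 1 => - (t - u)^-1 | 3, 1 => t / (t - u) | _, _ => 0 end).
apply/matrixP => i j; rewrite mxE 4!big_ord_recl big_ord0 /=.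
rewrite /line_through !mxE.
case: i => -[|[|i]] // lti; case: (splitP _) => k //= ek; try by case: k ek => -[].
all: by case: j => -[|[|j]] // ltj; rewrite !mxE //=; field.
Qed.

Lemma map_line_through (F K : fieldType) (f : {rmorphism F -> K}) (u v : 'rV[F]_4) :
  map_mx f (line_through u v) = line_through (map_mx f u) (map_mx f v).
Proof. exact: (map_col_mx f u v). Qed.

Lemma sub_line_through (F : fieldType) (m : nat) (u v : 'rV[F]_4) (A : 'M[F]_(m, 4)) :
  (line_through u v <= A)%MS = (u <= A)%MS && (v <= A)%MS.
Proof. exact: (col_mx_sub u v). Qed.

Lemma lin_comb_line_through (F : fieldType) (x y : F) (u v : 'rV[F]_4) :
  ((x *: u + y *: v)%R <= line_through u v)%MS.
Proof.
have /andP[uL vL] : (u <= line_through u v)%MS && (v <= line_through u v)%MS.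
  by rewrite -sub_line_through.
by apply: addmx_sub; apply: scalemx_sub.
Qed.

(** * The Frobenius map x -> x^q on extensions of F_q *)

Lemma fixed_codom (F : finFieldType) (L : fieldType) (f : {rmorphism F -> L}) (x : L) :
  x ^+ #|F| = x -> exists y, x = f y.
Proof.
move=> xq; have : root (map_poly f ('X^#|F| - 'X)) x.
  by rewrite rmorphB /= map_polyXn map_polyX rootE !hornerE xq subrr.
(* X^q - X is the product of the X - y over all y in F, so its roots in L all come from F. *)
rewrite finField_genPoly rmorph_prod /= (eq_bigr (fun y => 'X - (f y)%:P)); last first.
  by move=> y _; rewrite rmorphB /= map_polyX map_polyC.
rewrite -big_enum -(big_map f xpredT (fun z => 'X - z%:P)) root_prod_XsubC.
by case/mapP => y _ ->; exists y.
Qed.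

Lemma exprD_card (F : finFieldType) (L : fieldType) (f : {rmorphism F -> L}) (x y : L) :
  (x + y) ^+ #|F| = x ^+ #|F| + y ^+ #|F|.
Proof.
have [p pr_p charFp] := finPcharP F.
have oF : #|F| = (p ^ logn p #|F|)%N by exact: (card_pprimeChar charFp).
have charLp : p \in [pchar L] by exact: rmorph_pchar charFp.
apply: exprDn_pchar.
by rewrite oF pnatX pnatE // charLp.
Qed.

Lemma exprB_card (F : finFieldType) (L : fieldType) (f : {rmorphism F -> L}) (x y : L) :
  (x - y) ^+ #|F| = x ^+ #|F| - y ^+ #|F|.
Proof. by apply/eqP; rewrite eq_sym subr_eq -(exprD_card f) subrK. Qed.

Lemma expr_card_rmorph (F : finFieldType) (L : fieldType) (f : {rmorphism F -> L}) (x : F) :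
  f x ^+ #|F| = f x.
Proof. by rewrite -rmorphXn expf_card. Qed.

(** Frobenius fixes the coefficients, so t^q is a root of X^2 - s X + n, whose roots are t and s -
    t; t^q = t would put t in F. *)
Lemma quadratic_conj_root (F : finFieldType) (L : fieldType) (f : {rmorphism F -> L})
    (s n : F) (t : L) :
  t ^+ 2 = f s * t - f n -> (forall x, t <> f x) -> t ^+ #|F| = f s - t.
Proof.
move=> t2 tF.
have tq2 : (t ^+ #|F|) ^+ 2 = f s * t ^+ #|F| - f n.
  by rewrite -exprM mulnC exprM t2 (exprB_card f) exprMn !expr_card_rmorph.
have /eqP : (t ^+ #|F| - t) * (t ^+ #|F| - (f s - t)) = 0.
  by rewrite mulrBl !mulrBr -!expr2 tq2 t2; ring.
rewrite mulf_eq0 !subr_eq0 => /orP[]/eqP // tq.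
by have [y ty] := fixed_codom f tq; case: (tF y).
Qed.

(** * The quadratic extension K of F and its basis (t, 1) *)

Section Chords.
Variables (F K : finFieldType) (f : {rmorphism F -> K}).
Hypothesis cardK : #|K| = (#|F| ^ 2)%N.

(* The root is found in a splitting field over K, where Frobenius swaps the two
   roots, so that its square fixes them. *)
Lemma quadratic_root (s n : F) :
  (forall x : F, x ^+ 2 != s * x - n) ->
  exists t : K, t ^+ 2 = f s * t - f n /\ t \notin codom f.
Proof.
move=> noroot.
pose p : {poly K} := Poly [:: f n; - f s; 1].
have szp : size p = 3 by rewrite (@PolyK _ 0) //= oner_neq0.
have p0 : p != 0 by rewrite -size_poly_eq0 szp.
have [L [rs eqp _]] := FinSplittingFieldFor p0.
pose h : {rmorphism F -> L} := (in_alg L) \o f.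
have [t rt] : exists t : L, root (map_poly (in_alg L) p) t.
  case: rs eqp => [|t rs] eqp; last first.
    by exists t; rewrite (eqp_root eqp) big_cons rootM root_XsubC eqxx.
  by move/eqp_size: eqp; rewrite big_nil size_poly1 size_map_poly szp.
have t2 : t ^+ 2 = h s * t - h n.
  move: rt; rewrite /p /= !cons_poly_def !(rmorphD, rmorphM, rmorphN) /=.
  rewrite !map_polyX !map_polyC /= rootE !hornerE scale0r scale1r.
  rewrite mul0r add0r mul1r => /eqP rt; apply/eqP.
  by rewrite -subr_eq0; apply/eqP; rewrite -rt; ring.
have tF x : t <> h x.
  move=> tx; have /eqP := noroot x; apply; apply: (fmorph_inj h).
  by rewrite rmorphXn rmorphB rmorphM -tx.
have tq := quadratic_conj_root t2 tF.
have tqq : t ^+ #|K| = t.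
  by rewrite cardK expnS expn1 exprM tq (exprB_card h) expr_card_rmorph tq; ring.
have [u tu] := fixed_codom (in_alg L) tqq.
exists u; split; last first.
  by apply/codomP => -[x ux]; case: (tF x); rewrite tu ux.
by apply: (fmorph_inj (in_alg L)); rewrite rmorphXn rmorphB rmorphM -tu.
Qed.

Lemma codomN (t : K) : t \notin codom f -> forall x, t <> f x.
Proof. by move=> /negP tF x tx; apply: tF; rewrite tx codom_f. Qed.

Lemma basis_inj (t : K) (a b c d : F) : t \notin codom f ->
  f a * t + f b = f c * t + f d -> a = c /\ b = d.
Proof.
move=> tF e; have [ac|ac] := eqVneq a c.
  by split=> //; move: e; rewrite ac => /addrI /fmorph_inj.
case: (@codomN _ tF ((d - b) / (a - c))).
have ac0 : f (a - c) != 0 by rewrite fmorph_eq0 subr_eq0.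
rewrite fmorph_div; apply: (mulIf ac0); rewrite divfK // !rmorphB.
transitivity (f a * t + f b - f b - f c * t); first by ring.
by rewrite e; ring.
Qed.

(** By counting: (a, b) -> a t + b is injective between sets of size q^2. *)
Lemma basis_span (t : K) : t \notin codom f ->
  forall z, exists a b : F, z = f a * t + f b.
Proof.
move=> tF z.
have g_inj : injective (fun x : F * F => f x.1 * t + f x.2).
  by move=> [a b] [c d] /= /(basis_inj tF)[-> ->].
have /(_ _ z) := inj_card_onto g_inj.
rewrite card_prod cardK mulnn => /(_ (leqnn _))/codomP[[a b] ->].
by exists a, b.
Qed.

Lemma quadratic_relation (t : K) : t \notin codom f ->
  exists s n : F, t ^+ 2 = f s * t - f n.
Proof.
move=> tF; have [s [n ->]] := basis_span tF (t ^+ 2).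
by exists s, (- n); rewrite rmorphN opprK.
Qed.

Lemma conj_notin_codom (t : K) : t \notin codom f -> t ^+ #|F| \notin codom f.
Proof.
move=> tF; have [s [n t2]] := quadratic_relation tF.
rewrite (quadratic_conj_root t2 (@codomN _ tF)).
apply/codomP => -[x e]; case: (@codomN _ tF (s - x)).
by rewrite rmorphB -e; ring.
Qed.

Lemma conj_neq (t : K) : t \notin codom f -> t != t ^+ #|F|.
Proof.
move=> tF; apply/eqP => /esym/(fixed_codom f)[x tx].
exact: (codomN tF tx).
Qed.

Lemma conjK (t : K) : t ^+ #|F| ^+ #|F| = t.
Proof. by rewrite -exprM mulnn -cardK expf_card. Qed.

Lemma denom_neq0 (t : K) (c d : F) : t \notin codom f ->
  ~~ ((c == 0) && (d == 0)) -> f c * t + f d != 0.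
Proof.
(* Zero is rewritten as f 0 * t + f 0, the shape [basis_inj] compares with. *)
move=> tF; apply: contraNneq; rewrite -[0](addr0 0) -{1}(mul0r t) -(rmorph0 f).
by case/(basis_inj tF) => -> ->; rewrite !eqxx.
Qed.

(** * Imaginary chords and their images under G_q *)

Definition joins_conj (t : K) (L : 'M[F]_(2, 4)) :=
  (map_mx f L == line_through (Pt t) (Pt (t ^+ #|F|)))%MS.

(** One inclusion suffices: the joining line has rank 2 because t differs from t^q, and L has only
    two rows. *)
Lemma joins_conjI (t : K) (L : 'M[F]_(2, 4)) : t \notin codom f ->
  (Pt t <= map_mx f L)%MS -> (Pt (t ^+ #|F|) <= map_mx f L)%MS -> joins_conj t L.
Proof.
move=> tF tL tqL; have lineL : (line_through (Pt t) (Pt (t ^+ #|F|)) <= map_mx f L)%MS.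
  by rewrite sub_line_through tL.
have [le_rk] := mxrank_leqif_eq lineL.
rewrite rank_line_through ?conj_neq // in le_rk *.
have -> : \rank (map_mx f L) = 2 by apply/eqP; rewrite eqn_leq rank_leq_row.
by rewrite eqxx /joins_conj andbC => <-.
Qed.

Lemma joins_conj_chord (t : K) (L : 'M[F]_(2, 4)) :
  t \notin codom f -> joins_conj t L -> imag_chord f L.
Proof.
move=> tF tL; split; last by exists t.
by rewrite /is_line -(mxrank_map f) (eqmxP tL) rank_line_through ?conj_neq.
Qed.

(** Since t^q = s - t is the other root, a check made for an arbitrary root w covers both conjugate
    points. *)
Lemma root_joins_conj (s n : F) (t : K) (L : 'M[F]_(2, 4)) :
  t \notin codom f -> t ^+ 2 = f s * t - f n ->
  (forall w : K, w ^+ 2 = f s * w - f n -> (Pt w <= map_mx f L)%MS) -> joins_conj t L.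
Proof.
move=> tF t2 hL; apply: joins_conjI => //; apply: hL => //.
rewrite (quadratic_conj_root t2 (@codomN _ tF)) sqrrB t2; ring.
Qed.

Lemma chord_exists : exists L : 'M[F]_(2, 4), imag_chord f L.
Proof.
have [t tF] : exists t, t \notin codom f.
  apply/existsP; rewrite -negb_forall; apply/negP => /forallP fF.
  have : (#|K| <= #|F|)%N.
    rewrite -(card_codom (fmorph_inj f)); apply: subset_leq_card.
    by apply/subsetP => x _; apply: fF.
  rewrite cardK leqNgt -{1}[#|F|]expn1 ltn_exp2l //.
  exact: finNzRing_gt1.
have [s [n t2]] := quadratic_relation tF.
(* Reduction modulo t^2 = s t - n gives t^3 = (s^2 - n) t - s n, so P(t) = t u0 + v0 with u0 and v0
   over F. *)
pose u0 := pt (s ^+ 2 - n) s 1 0; pose v0 := pt (- (s * n)) (- n) 0 1.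
exists (line_through u0 v0).
apply: (joins_conj_chord tF); apply: (root_joins_conj tF t2) => w w2.
have -> : Pt w = w *: map_mx f u0 + map_mx f v0.
  rewrite !map_pt scale_pt add_pt !(rmorphB, rmorphN, rmorphM, rmorphXn, rmorph0, rmorph1) /=.
  by apply/pt_inj; split; rewrite ?[w ^+ 3]exprS ?w2; ring: w2.
rewrite map_line_through.
by have := lin_comb_line_through w 1 (map_mx f u0) (map_mx f v0); rewrite scale1r.
Qed.

Lemma mobius_denom_neq0 (t : K) (a b c d : F) : t \notin codom f ->
  a * d - b * c != 0 -> f c * t + f d != 0.
Proof.
move=> tF det0; apply: denom_neq0 => //; apply: contraNN det0 => /andP[/eqP-> /eqP->].
by rewrite !mulr0 subr0.
Qed.

Lemma mobius_notin_codom (t : K) (a b c d : F) : t \notin codom f ->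
  a * d - b * c != 0 -> (f a * t + f b) / (f c * t + f d) \notin codom f.
Proof.
move=> tF det0; have den0 := mobius_denom_neq0 tF det0.
apply/codomP => -[x /(canRL (divfK den0))].
(* An image x in F would force a = x c and b = x d, hence a zero determinant. *)
rewrite mulrDr mulrA -!rmorphM => /(basis_inj tF)[ea eb].
by move/eqP: det0; apply; rewrite ea eb; ring.
Qed.

Lemma Pt_Mabcd (t : K) (a b c d : F) : f c * t + f d != 0 ->
  Pt t *m map_mx f (Mabcd a b c d) =
  (f c * t + f d) ^+ 3 *: Pt ((f a * t + f b) / (f c * t + f d)).
Proof.
by move=> den0; rewrite map_Mabcd Pt_vpt vpt_Mabcd !mulr1 vpt_Pt.
Qed.

Lemma joins_conj_Mabcd (t : K) (L : 'M[F]_(2, 4)) (a b c d : F) : t \notin codom f ->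
  a * d - b * c != 0 -> joins_conj t L ->
  joins_conj ((f a * t + f b) / (f c * t + f d)) (L *m Mabcd a b c d).
Proof.
have image_sub (w : K) : w \notin codom f -> a * d - b * c != 0 ->
    (Pt w <= map_mx f L)%MS ->
    (Pt ((f a * w + f b) / (f c * w + f d))%R <= map_mx f (L *m Mabcd a b c d))%MS.
  move=> wF det0 wL; have den0 := mobius_denom_neq0 wF det0.
  rewrite -(eqmx_scale _ (expf_neq0 3 den0)) -Pt_Mabcd // map_mxM.
  exact: submxMr.
move=> tF det0 tL.
have : (line_through (Pt t) (Pt (t ^+ #|F|)) <= map_mx f L)%MS by case/andP: tL.
rewrite sub_line_through => /andP[tL1 tL2].
apply: joins_conjI; [exact: mobius_notin_codom | exact: image_sub |].
(* The coefficients lie in F, so the conjugate of the image of t is the image of t^q. *)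
rewrite expr_div_n !(exprD_card f) !exprMn !expr_card_rmorph.
by apply: image_sub => //; apply: conj_notin_codom.
Qed.

(** Inclusion of row spaces over F can be tested after extending scalars to K. *)
Lemma joins_conj_eq (t : K) (L1 L2 : 'M[F]_(2, 4)) :
  joins_conj t L1 -> joins_conj t L2 -> (L1 == L2)%MS.
Proof.
move=> /andP[L1t tL1] /andP[L2t tL2].
by rewrite -!(map_submx f) (submx_trans L1t tL2) (submx_trans L2t tL1).
Qed.

Lemma joins_conjC (t : K) (L : 'M[F]_(2, 4)) : t \notin codom f ->
  joins_conj t L -> joins_conj (t ^+ #|F|) L.
Proof.
move=> tF /andP[_]; rewrite sub_line_through => /andP[tL tqL].
by apply: joins_conjI; rewrite ?conjK ?conj_notin_codom.
Qed.

Lemma imag_chord_Mabcd (L : 'M[F]_(2, 4)) (a b c d : F) : imag_chord f L ->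
  a * d - b * c != 0 -> imag_chord f (L *m Mabcd a b c d).
Proof.
move=> [_ [t [tF tL]]] det0; have := joins_conj_Mabcd tF det0 tL.
exact: joins_conj_chord (mobius_notin_codom tF det0).
Qed.

(* The F-basis (1, t1) of K yields an affine map sending t1 to t2. *)
Lemma imag_chord_transitive (L1 L2 : 'M[F]_(2, 4)) :
  imag_chord f L1 -> imag_chord f L2 ->
  exists a b c d : F, a * d - b * c != 0 /\ (L1 *m Mabcd a b c d == L2)%MS.
Proof.
move=> [_ [t1 [t1F tL1]]] [_ [t2 [t2F tL2]]].
have [a [b e]] := basis_span t1F t2.
have det0 : a * 1 - b * 0 != 0.
  rewrite mulr1 mulr0 subr0; apply: contraNneq t2F => a0.
  by rewrite e a0 rmorph0 mul0r add0r codom_f.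
exists a, b, 0, 1; split=> //; apply: (joins_conj_eq _ tL2).
have := joins_conj_Mabcd t1F det0 tL1.
by rewrite rmorph0 rmorph1 mul0r add0r divr1 -e.
Qed.

Lemma Mabcd_fixes_chord (t : K) (L : 'M[F]_(2, 4)) (a b c d : F) : t \notin codom f ->
  joins_conj t L -> a * d - b * c != 0 ->
  (L *m Mabcd a b c d == L)%MS <->
  f a * t + f b = (f c * t + f d) * t \/ f a * t + f b = (f c * t + f d) * t ^+ #|F|.
Proof.
move=> tF tL det0; have den0 := mobius_denom_neq0 tF det0.
have wL := joins_conj_Mabcd tF det0 tL.
set w := _ / _ in wL; have wE u : w = u <-> f a * t + f b = (f c * t + f d) * u.
  by rewrite /w; split=> [<-|->]; [rewrite [RHS]mulrC divfK | rewrite mulrC mulKf].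
rewrite -!wE; split=> [LM|w_t].
  have : (Pt w <= line_through (Pt t) (Pt (t ^+ #|F|)))%MS.
    rewrite -(eqmxP tL); move: LM; rewrite -(map_submx f) -(map_submx f).
    case/andP=> LM _; apply: submx_trans LM.
    by case/andP: wL => _; rewrite sub_line_through => /andP[].
  exact: Pt_line_through.
(* Either conjugate parameter determines the same chord. *)
by apply: (joins_conj_eq wL); case: w_t => ->; rewrite // joins_conjC.
Qed.

(** * The stabiliser of an imaginary chord and its size *)

Lemma mem_projclass (M : 'M[F]_4) : M \in projclass M.
Proof. by rewrite inE; apply/existsP; exists 1; rewrite oner_neq0 scale1r eqxx. Qed.

Lemma projclass_eqP (M N : 'M[F]_4) :
  projclass M = projclass N <-> exists2 k : F, k != 0 & M = k *: N.
Proof.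
split=> [MN|[k k0 ->]].
  have := mem_projclass M; rewrite MN inE => /existsP[k /andP[k0 /eqP->]].
  by exists k.
apply/setP => P; rewrite !inE; apply/existsP/existsP => -[h /andP[h0 /eqP->]].
  by exists (h * k); rewrite mulf_neq0 // scalerA eqxx.
by exists (h / k); rewrite mulf_neq0 ?invr_eq0 // scalerA divfK ?eqxx.
Qed.

Lemma Mabcd_scale (k a b c d : F) :
  Mabcd (k * a) (k * b) (k * c) (k * d) = k ^+ 3 *: Mabcd a b c d.
Proof. by apply/matrixP; elim/ord4E; elim/ord4E; rewrite !mxE !inordK //=; ring. Qed.

(** Nonzero scalars do not change row spaces, so one representative decides for its whole class. *)
Lemma stabP (L : 'M[F]_(2, 4)) (g : {set 'M[F]_4}) :
  g \in stab L <-> exists a b c d : F, [/\ a * d - b * c != 0,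
    (L *m Mabcd a b c d == L)%MS & g = projclass (Mabcd a b c d)].
Proof.
rewrite inE; split=> [/andP[/imsetP[[[a b] [c d]]]]|[a [b [c [d [det0 LM ->]]]]]].
  rewrite inE /= => det0 -> /forall_inP/(_ _ (mem_projclass _)) LM.
  by exists a, b, c, d.
apply/andP; split; first by apply/imsetP; exists ((a, b), (c, d)); rewrite ?inE.
apply/forall_inP => N; rewrite inE => /existsP[k /andP[k0 /eqP->]].
by rewrite -scalemxAr !(eqmx_scale _ k0).
Qed.

(* Elements of the stabiliser of the chord through the roots t, t' of
   X^2 - s X + n: u |-> (a u + b) / (c u + d) fixes t and t' or, if [swap],
   exchanges them. *)
Definition Mstab (s n : F) (swap : bool) (c d : F) : 'M[F]_4 :=
  if swap then Mabcd (- d) (c * n + d * s) c d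
  else Mabcd (c * s + d) (- (c * n)) c d.

Section Stabiliser.
Variables (s n : F) (t : K) (L : 'M[F]_(2, 4)).
Hypotheses (tF : t \notin codom f) (t2 : t ^+ 2 = f s * t - f n) (tL : joins_conj t L).

Let tq : t ^+ #|F| = f s - t := quadratic_conj_root t2 (@codomN _ tF).

(** This form is the norm (c t + d)(c t^q + d) of a nonzero element; up to sign it is also the
    determinant a d - b c attached to [Mstab]. *)
Lemma norm_neq0 (c d : F) : ~~ ((c == 0) && (d == 0)) -> d ^+ 2 + s * c * d + n * c ^+ 2 != 0.
Proof.
move=> cd0; rewrite -(fmorph_eq0 f).
have -> : f (d ^+ 2 + s * c * d + n * c ^+ 2) =
    (f c * t + f d) * (f c * t ^+ #|F| + f d).
  rewrite tq !(rmorphD, rmorphM, rmorphXn) /=.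
  by apply/eqP; rewrite -subr_eq0; apply/eqP; ring: t2.
by rewrite mulf_neq0 ?denom_neq0 ?conj_notin_codom.
Qed.

Lemma stab_Mstab (g : {set 'M[F]_4}) :
  g \in stab L <-> exists (swap : bool) (c d : F),
    ~~ ((c == 0) && (d == 0)) /\ g = projclass (Mstab s n swap c d).
Proof.
rewrite stabP; split=> [[a [b [c [d [det0 LM ->]]]]]|[swap [c [d [cd0 ->]]]]].
  have cd0 : ~~ ((c == 0) && (d == 0)).
    by apply: contraNN det0 => /andP[/eqP-> /eqP->]; rewrite !mulr0 subr0.
  have [e|e] := (Mabcd_fixes_chord tF tL det0).1 LM.
    exists false, c, d; split=> //; rewrite /Mstab.
    (* Expand (c t + d) t with t^2 = s t - n, then compare coefficients in the basis (t, 1). *)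
    have : f a * t + f b = f (c * s + d) * t + f (- (c * n)).
      by rewrite e !(rmorphD, rmorphM, rmorphN) /=; ring: t2.
    by case/(basis_inj tF) => -> ->.
  exists true, c, d; split=> //; rewrite /Mstab.
  (* The same expansion for (c t + d)(s - t). *)
  have : f a * t + f b = f (- d) * t + f (c * n + d * s).
    by rewrite e tq !(rmorphD, rmorphM, rmorphN) /=; ring: t2.
  by case/(basis_inj tF) => -> ->.
have norm0 := norm_neq0 cd0.
case: swap; rewrite /Mstab.
  have det0 : - d * d - (c * n + d * s) * c != 0.
    by rewrite -oppr_eq0; apply: contraNneq norm0 => <-; apply/eqP; ring.
  exists (- d), (c * n + d * s), c, d; split=> //.
  apply/(Mabcd_fixes_chord tF tL det0); right.
  by rewrite tq !(rmorphD, rmorphM, rmorphN) /=; ring: t2.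
have det0 : (c * s + d) * d - - (c * n) * c != 0.
  by apply: contraNneq norm0 => <-; apply/eqP; ring.
exists (c * s + d), (- (c * n)), c, d; split=> //.
apply/(Mabcd_fixes_chord tF tL det0); left.
by rewrite !(rmorphD, rmorphM, rmorphN) /=; ring: t2.
Qed.

Lemma Mstab_scale (swap : bool) (k c d : F) :
  Mstab s n swap (k * c) (k * d) = k ^+ 3 *: Mstab s n swap c d.
Proof.
rewrite /Mstab; case: swap; rewrite -Mabcd_scale; congr Mabcd; ring.
Qed.

(** The image of P(t), which is P(t) or P(t^q), reveals [swap]; the image of P(infinity) then
    reveals (c : d). *)
Lemma Mstab_proportional (k c d c' d' : F) (swap swap' : bool) :
  ~~ ((c == 0) && (d == 0)) -> ~~ ((c' == 0) && (d' == 0)) -> k != 0 ->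
  Mstab s n swap c d = k *: Mstab s n swap' c' d' ->
  swap = swap' /\ c * d' = c' * d.
Proof.
move=> cd0 cd0' k0.
have den0 := denom_neq0 tF cd0; have den0' := denom_neq0 tF cd0'.
have image b : forall u v, ~~ ((u == 0) && (v == 0)) -> vpt t 1 *m map_mx f (Mstab s n b u v) =
   (f u * t + f v)^+3 *: Pt (if b then t ^+ #|F| else t).
  move=> u v uv0; have d0 := denom_neq0 tF uv0.
  rewrite /Mstab; case: b; rewrite -Pt_vpt Pt_Mabcd //; congr (_ *: Pt _).
    by apply: (mulIf d0); rewrite divfK // tq !(rmorphD, rmorphM, rmorphN) /=; ring: t2.
  by apply: (mulIf d0); rewrite divfK // !(rmorphD, rmorphM, rmorphN) /=; ring: t2.
move=> e; have swapE : swap = swap'.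
  have := congr1 (fun M => vpt t 1 *m map_mx f M) e.
  rewrite map_mxZ -scalemxAr !image // !scalerA => ePt.
  have : (Pt (if swap then t ^+ #|F| else t) <= Pt (if swap' then t ^+ #|F| else t))%MS.
    rewrite -(eqmx_scale _ (expf_neq0 3 den0)) ePt; exact: scalemx_sub.
  move/sub_rVP => [h]; rewrite !scale_pt => /pt_inj[_ _ e2 /esym].
  rewrite mulr1 => h1; move: e2; rewrite h1 mul1r.
  by case: (swap) (swap') => -[] // e2; case/eqP: (conj_neq tF).
split=> //; move: e; rewrite -{}swapE => e.
have colin x y := congr1 (fun M => vpt x y *m M) e.
apply/eqP; rewrite -subr_eq0; apply/eqP.
(* The image of P(infinity) has parameter (a : c), that is (- d : c) or (c s + d : c). *)
move: (colin 1 0); rewrite /Mstab -scalemxAr; case: swap {image e colin}.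
  rewrite !vpt_Mabcd => /(vpt_proportional k0)/eqP.
  by rewrite -subr_eq0 => /eqP <-; ring.
rewrite !vpt_Mabcd => /(vpt_proportional k0)/esym/eqP.
by rewrite -subr_eq0 => /eqP <-; ring.
Qed.

Lemma card_stab : #|stab L| = (2 * (#|F| + 1))%N.
Proof.
(* [option F] enumerates the q + 1 points (1 : d) and (0 : 1) of the projective line; [swap]
   contributes the factor 2. *)
pose cd (x : option F) : F * F := if x is Some d then (1, d) else (0, 1).
have cd0 x : ~~ (((cd x).1 == 0) && ((cd x).2 == 0)).
  by case: x => [d|] /=; rewrite oner_eq0 ?andbF.
pose h (x : bool * option F) := projclass (Mstab s n x.1 (cd x.2).1 (cd x.2).2).
have h_inj : injective h.
  move=> [e x] [e' x'] /projclass_eqP[k k0].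
  case/(Mstab_proportional (cd0 x) (cd0 x') k0) => /= -> {e}.
  case: x x' => [d|] [d'|] //=; rewrite ?mul1r ?mul0r ?mulr1.
  - by move=> ->.
  - by move/eqP; rewrite oner_eq0.
  - by move/eqP; rewrite eq_sym oner_eq0.
have -> : stab L = [set h x | x in {: bool * option F}].
  apply/setP => g; apply/idP/imsetP => [/stab_Mstab[e [c [d [cd_n0 ->]]]]|[[e x] _ ->]].
    have [c0|c0] := eqVneq c 0.
      have d0 : d != 0 by move: cd_n0; rewrite c0 eqxx.
      exists (e, None) => //; apply/projclass_eqP; exists (d ^+ 3); first exact: expf_neq0.
      by rewrite -Mstab_scale /= mulr0 mulr1 c0.
    exists (e, Some (d / c)) => //; apply/projclass_eqP.
    exists (c ^+ 3); first exact: expf_neq0.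
    by rewrite -Mstab_scale /= mulr1 mulrC divfK.
  by apply/stab_Mstab; exists e, (cd x).1, (cd x).2.
by rewrite card_imset // card_prod card_bool card_option addn1.
Qed.
End Stabiliser.
End Chords.

(** * The chords [ell1] and [ell2] and the matrices fixing them *)

Section Families.
Variables (F K : finFieldType) (f : {rmorphism F -> K}).
Hypothesis cardK : #|K| = (#|F| ^ 2)%N.

Lemma non_square_neq0 (rho : F) : ~~ is_square rho -> rho != 0.
Proof. by apply: contraNneq => ->; apply/existsP; exists 0; rewrite expr0n. Qed.

Lemma ell1_joins_conj (rho : F) : ~~ is_square rho ->
  exists t : K, [/\ t \notin codom f, t ^+ 2 = f 0 * t - f (- rho^-1) &
    joins_conj f t (ell1 rho)].
Proof.
move=> rho_nsq.
have rho0 := non_square_neq0 rho_nsq.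
(* A square root of 1 / rho would have an inverse whose square is rho. *)
have noroot (x : F) : x ^+ 2 != 0 * x - (- rho^-1).
  rewrite mul0r sub0r opprK; apply: contraNneq rho_nsq => x2.
  by apply/existsP; exists x^-1; rewrite exprVn x2 invrK.
have [t [t2 tF]] := quadratic_root f cardK noroot.
exists t; split=> //; apply: (root_joins_conj tF t2) => w.
rewrite rmorph0 mul0r sub0r rmorphN opprK => w2.
have frho0 : f rho != 0 by rewrite fmorph_eq0.
rewrite /ell1 map_line_through.
have -> : Pt w = (w / f rho) *: map_mx f (pt 1 0 rho 0) + (f rho)^-1 *: map_mx f (pt 0 1 0 rho).
  rewrite !map_pt !scale_pt add_pt !rmorph0 !rmorph1 -fmorphV -w2.
  apply/pt_inj; split; rewrite ?[w ^+ 3]exprS ?w2 ?fmorphV; by field.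
exact: lin_comb_line_through.
Qed.

(** For alpha = 1 or -1, [Psi_odd rho alpha b d] is M(alpha d, b, alpha rho b, d), so b = alpha c /
    rho; swapping corresponds to alpha = -1. *)
Lemma Mstab_ell1 (rho : F) (swap : bool) (c d : F) : rho != 0 ->
  Mstab 0 (- rho^-1) swap c d =
  if swap then Psi_odd rho (-1) (- (c / rho)) d else Psi_odd rho 1 (c / rho) d.
Proof.
move=> rho0; case: swap; rewrite /Mstab /Mabcd /Psi_odd; congr mx4; by field.
Qed.

Lemma even_pchar2 : ~~ odd #|F| -> 2%N \in [pchar F].
Proof.
have [p pr_p charFp] := finPcharP F; rewrite (card_pprimeChar charFp) oddX negb_or.
by case/andP => _; case: (even_prime pr_p) => [<-|->].
Qed.

(** The sum telescopes to x^q - x. *)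
Lemma abs_trace_artin_schreier (x : F) : 2%N \in [pchar F] -> abs_trace (x ^+ 2 - x) = 0.
Proof.
move=> char2; rewrite /abs_trace.
transitivity (\sum_(0 <= i < logn 2 #|F|) (x ^+ (2 ^ i.+1) - x ^+ (2 ^ i))).
  rewrite big_mkord; apply: eq_bigr => i _.
  rewrite exprDn_pchar ?pnatX ?pnatE ?char2 // !(oppr_pchar2 char2).
  by rewrite -exprM expnS.
rewrite telescope_sumr // -(card_pprimeChar char2) expf_card; ring.
Qed.

Lemma ell2_joins_conj (eta : F) : 2%N \in [pchar F] -> abs_trace eta = 1 ->
  exists t : K, [/\ t \notin codom f, t ^+ 2 = f 1 * t - f eta &
    joins_conj f t (ell2 eta)].
Proof.
move=> char2 tr1.
(* A root would give eta = x^2 - x in characteristic 2, of trace 0 instead of 1. *)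
have noroot (x : F) : x ^+ 2 != 1 * x - eta.
  apply/eqP => x2; have := abs_trace_artin_schreier x char2.
  rewrite x2 mul1r addrAC subrr add0r (oppr_pchar2 char2) tr1 => /eqP.
  by rewrite oner_eq0.
have [t [t2 tF]] := quadratic_root f cardK noroot.
exists t; split=> //; apply: (root_joins_conj tF t2) => w.
have char2K := rmorph_pchar f char2.
rewrite rmorph1 mul1r (oppr_pchar2 char2K) => w2.
rewrite /ell2 map_line_through.
have -> : Pt w = w *: map_mx f (pt (eta + 1) 1 1 0) + 1 *: map_mx f (pt eta eta 0 1).
  rewrite !map_pt !scale_pt add_pt !rmorphD !rmorph0 !rmorph1.
  by apply/pt_inj; split; ring: w2.
exact: lin_comb_line_through.
Qed.

(** With 2 = 0 and 3 = 1, [Psi_even] is M(A, B, c, d); alpha = 0 gives (A, B) = (d, eta c + d),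
    which swaps, and alpha = 1 gives (c + d, eta c). *)
Lemma Mstab_ell2 (eta : F) (swap : bool) (c d : F) : 2%N \in [pchar F] ->
  Mstab 1 eta swap c d = Psi_even eta (if swap then 0 else 1) c d.
Proof.
move=> char2; have two0 : 2%:R = 0 :> F by exact: pcharf0.
have three1 : 3%:R = 1 :> F by rewrite (natrD _ 2 1) two0 add0r.
case: swap; rewrite /Mstab /Psi_even /Mabcd three1 two0 ?mulr1;
  rewrite !(oppr_pchar2 char2) ?mul0r ?mul1r ?add0r ?addr0 ?(addrr_pchar2 char2);
  congr mx4; ring.
Qed.
End Families.

Unset Implicit Arguments.

Theorem theorem5p4 (F K : finFieldType) (f : {rmorphism F -> K}) :
  (5 <= #|F|)%N -> #|K| = (#|F| ^ 2)%N ->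
  [/\ (* the imaginary chords form one G_q-orbit *)
      ((exists L : 'M[F]_(2,4), imag_chord f L) /\
      (forall (L : 'M[F]_(2,4)) (a b c d : F), imag_chord f L ->
         a * d - b * c != 0 -> imag_chord f (L *m Mabcd a b c d)) /\
      (forall L1 L2 : 'M[F]_(2,4), imag_chord f L1 -> imag_chord f L2 ->
         exists a b c d : F, a * d - b * c != 0 /\
           (L1 *m Mabcd a b c d == L2)%MS)),
      (* stabiliser size *)
      (forall L : 'M[F]_(2,4), imag_chord f L -> #|stab L| = (2 * (#|F| + 1))%N),
      (* q odd *)
      (odd #|F| -> forall rho : F, ~~ is_square rho ->
         imag_chord f (ell1 rho) /\
         forall g, g \in stab (ell1 rho) ->
           exists alpha b d : F, [/\ alpha = 1 \/ alpha = -1,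
             ~~ ((b == 0) && (d == 0)) & Psi_odd rho alpha b d \in g]) &
      (* q even *)
      (~~ odd #|F| -> forall eta : F, abs_trace eta = 1 ->
         imag_chord f (ell2 eta) /\
         forall g, g \in stab (ell2 eta) ->
           exists alpha c d : F, [/\ alpha = 0 \/ alpha = 1,
             ~~ ((c == 0) && (d == 0)) & Psi_even eta alpha c d \in g])].
Proof.
move=> _ cardK; split.
- split; first exact: chord_exists; split=> [L a b c d|L1 L2].
    exact: imag_chord_Mabcd.
  exact: imag_chord_transitive.
- move=> L [_ [t [tF tL]]]; have [s [n t2]] := quadratic_relation cardK tF.
  exact: card_stab tF t2 tL.
- move=> _ rho rho_nsq; have [t [tF t2 tL]] := ell1_joins_conj f cardK rho_nsq.
  split=> [|g /(stab_Mstab cardK tF t2 tL)[swap [c [d [cd0 ->]]]]].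
    exact: (joins_conj_chord tF tL).
  have rho0 := non_square_neq0 rho_nsq.
  (* Passing from c to b = c / rho or - c / rho preserves the condition that the parameters are not
     both 0. *)
  have crho x : ((x / rho == 0) = (x == 0)) * ((- (x / rho) == 0) = (x == 0)).
    by rewrite oppr_eq0 mulf_eq0 invr_eq0 (negPf rho0) orbF.
  have := mem_projclass (Mstab 0 (- rho^-1) swap c d).
  rewrite {1}Mstab_ell1 //; case: swap => Psi_g.
    by exists (-1), (- (c / rho)), d; rewrite crho; split=> //; right.
  by exists 1, (c / rho), d; rewrite crho; split=> //; left.
- move=> /even_pchar2 char2 eta tr1.
  have [t [tF t2 tL]] := ell2_joins_conj f cardK char2 tr1.
  split=> [|g /(stab_Mstab cardK tF t2 tL)[swap [c [d [cd0 ->]]]]].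
    exact: (joins_conj_chord tF tL).
  exists (if swap then 0 else 1), c, d; rewrite -Mstab_ell2 //.
  by split=> //; [case: swap; [left|right] | exact: mem_projclass].
Qed.
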